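(* Let $\varepsilon>0$ be fixed, and let $(\mathfrak{X}^{(t)})_{t\ge1}$ be a sequence of primitive coherent configurations whose numbers of vertices $n=n(t)$ tend to infinity, such that $\rho/n^{2/3}\to 0$, and such that in each $\mathfrak{X}^{(t)}$ every nondominant color $i$ satisfies $\lambda_i\ge \varepsilon n^{1/2}$. Then for all sufficiently large $t$ there is a clique geometry $\mathcal{G}^{(t)}$ on $\mathfrak{X}^{(t)}$, and these clique geometries are asymptotically uniform.
   Context: A primitive coherent configuration (PCC) on a finite set $V$, $|V|=n$, is a map $c:V\times V\to\{0,\ldots,r-1\}$ such that: color $0$ is exactly the set of diagonal pairs; for every color $i$ there is $i^*$ with $c(u,v)=i$ iff $c(v,u)=i^*$; for all $i,j,k$ there is $p^i_{jk}$ such that whenever $c(u,v)=i$, exactly $p^i_{jk}$ vertices $w$ satisfy $c(u,w)=j$, $c(w,v)=k$; and each digraph $(V,\{(u,v):c(u,v)=i\})$, $i\ne0$, is strongly connected. $\mathfrak{X}_i(u)=\{v:c(u,v)=i\}$, $n_i=|\mathfrak{X}_i(u)|$. Colors are indexed so that $n_1=\max_i n_i$, and $\rho=n-n_1-1$. A color $i\ne0$ is nondominant if $n_i<n/2$. $G(\mathfrak{X})$ is the (undirected) graph on $V$ in which distinct $u,v$ are adjacent iff $c(u,v)$ is nondominant; $N(v)$ is the neighborhood of $v$ in $G(\mathfrak{X})$. For a nondominant color $i$, $\lambda_i=|\mathfrak{X}_i(u)\cap N(v)|$ for any $u,v$ with $c(u,v)=i$ (well defined by coherence). A clique geometry on $\mathfrak{X}$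 is a collection $\mathcal{G}$ of maximal cliques of $G(\mathfrak{X})$ such that every pair of adjacent vertices of $G(\mathfrak{X})$ lies in exactly one clique of $\mathcal{G}$. A sequence of clique geometries $\mathcal{G}^{(t)}$ on $\mathfrak{X}^{(t)}$ is asymptotically uniform if the maximum of $\left||C\cap\mathfrak{X}_i(u)|/\lambda_i - 1\right|$ over all $C\in\mathcal{G}^{(t)}$, $u\in C$ and nondominant colors $i$ with $C\cap \mathfrak{X}_i(u)\ne\emptyset$ tends to $0$ as $t\to\infty$. *)

(* Defs.v *)
From mathcomp Require Import all_boot all_order all_algebra.
From mathcomp Require Import all_classical all_reals all_analysis.

Set Implicit Arguments.
Unset Strict Implicit.
Unset Printing Implicit Defensive.

Import Order.TTheory GRing.Theory Num.Theory.
Import numFieldNormedType.Exports.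

Local Open Scope ring_scope.

(* A colouring [c u v : 'I_r] assigns to an ordered pair a colour in
   {0, ..., r - 1}; colours are compared as natural numbers, so that the
   colours 0 and 1 can be named without any assumption on [r]. *)

Definition sphere (V : finType) (r : nat) (c : V -> V -> 'I_r)
    (i : nat) (u : V) : {set V} :=
  [set v | c u v == i :> nat].

(* n_i = |X_i(u)|, which does not depend on u in a coherent configuration:
   see [valencyE]. *)
Definition valency (V : finType) (r : nat) (c : V -> V -> 'I_r)
    (i : nat) : nat :=
  (\max_(u : V) #|sphere c i u|)%N.

(* [pcc_max] is the convention on the indexing of the colours. The colour 0
   can be left out of it: n_0 = 1, and n_i >= 1 for every colour i as soon as
   #|V| > 1, by [pcc_primitive]; the configuration on one point has no
   colour 1. *)
Record is_pcc (V : finType) (r : nat) (c : V -> V -> 'I_r) : Prop := IsPCC {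
  pcc_diag : forall u v : V, c u v = 0%N :> nat <-> u = v;
  pcc_conv : forall i : 'I_r, exists i' : 'I_r,
    forall u v : V, c u v = i <-> c v u = i';
  pcc_inter : forall i j k : 'I_r, exists p : nat,
    forall u v : V, c u v = i ->
      #|[set w | (c u w == j) && (c w v == k)]| = p;
  pcc_primitive : forall i : 'I_r, i != 0%N :> nat ->
    forall u v : V, connect (fun x y : V => c x y == i) u v;
  pcc_max : forall i : 'I_r, i != 0%N :> nat ->
    (valency c i <= valency c 1)%N
}.

(* The truncated subtraction is exact when V is not empty, since u is not in
   X_1(u). *)
Definition rho (V : finType) (r : nat) (c : V -> V -> 'I_r) : nat :=
  (#|V| - valency c 1 - 1)%N.

Definition nondominant (V : finType) (r : nat) (c : V -> V -> 'I_r)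
    (i : nat) : bool :=
  (i != 0%N) && (2 * valency c i < #|V|)%N.

(* The graph G(X); it is undirected by [adj_sym]. *)
Definition adj (V : finType) (r : nat) (c : V -> V -> 'I_r) : rel V :=
  fun u v => (u != v) && nondominant c (c u v).

Definition neighborhood (V : finType) (r : nat) (c : V -> V -> 'I_r)
    (v : V) : {set V} :=
  [set w | adj c v w].

(* lambda_i = |X_i(u) :&: N(v)| for any u, v such that c u v = i: see
   [lambdaE]. *)
Definition lambda (V : finType) (r : nat) (c : V -> V -> 'I_r)
    (i : nat) : nat :=
  (\max_(uv : V * V | c uv.1 uv.2 == i :> nat)
     #|sphere c i uv.1 :&: neighborhood c uv.2|)%N.

Definition clique (V : finType) (e : rel V) (C : {set V}) : bool :=
  [forall u in C, forall v in C, (u != v) ==> e u v].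

Definition clique_geometry (V : finType) (r : nat) (c : V -> V -> 'I_r)
    (G : {set {set V}}) : Prop :=
  (forall C : {set V}, C \in G -> maxset (clique (adj c)) C) /\
  (forall u v : V, adj c u v ->
     exists! C : {set V}, [/\ C \in G, u \in C & v \in C]).

(* The maximum of an empty family is 0. *)
Definition deviation (R : realType) (V : finType) (r : nat)
    (c : V -> V -> 'I_r) (G : {set {set V}}) : R :=
  \big[Num.max/0]_(C in G) \big[Num.max/0]_(u in C)
  \big[Num.max/0]_(i < r | nondominant c i && (C :&: sphere c i u != finset.set0))
    `| #|C :&: sphere c i u|%:R / (lambda c i)%:R - 1 |.

Definition asymptotically_uniform (R : realType) (V : nat -> finType)
    (r : nat -> nat) (c : forall t, V t -> V t -> 'I_(r t))
    (G : forall t, {set {set V t}}) : Prop :=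
  (deviation R (c t) (G t) @[t --> \oo] --> (0 : R))%classic.

Lemma valencyE (V : finType) (r : nat) (c : V -> V -> 'I_r) (i : 'I_r)
    (u : V) : is_pcc c -> #|sphere c i u| = valency c i.
Proof.
move=> h; suff eqs x y : #|sphere c i x| = #|sphere c i y|.
  apply/eqP; rewrite eqn_leq (leq_bigmax u) /=.
  by apply/bigmax_leqP => x _; rewrite (eqs x u).
have [i' hi'] := pcc_conv h i.
have [p hp] := pcc_inter h (c x x) i i'.
have cd : c y y = c x x.
  by apply: val_inj; rewrite /= !(pcc_diag h _ _).2.
have E z : sphere c i z = [set w | (c z w == i) && (c w z == i')].
  apply/setP => w; rewrite !inE -val_eqE.
  case: eqP => [/val_inj/(hi' z w).1 ->|//]; exact/esym/eqP.
by rewrite !E !hp.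
Qed.

Lemma valency_conv (V : finType) (r : nat) (c : V -> V -> 'I_r) (u v : V) :
  is_pcc c -> valency c (c u v) = valency c (c v u).
Proof.
move=> h; have V0 : (0 < #|V|)%N by apply/card_gt0P; exists u.
apply/eqP; rewrite -(eqn_pmul2l V0); apply/eqP.
have S (i : 'I_r) :
    (#|V| * valency c i = \sum_(x : V) \sum_(y : V) (c x y == i))%N.
  rewrite -sum_nat_const; apply: eq_bigr => x _.
  rewrite -(valencyE i x h) -sum1_card big_mkcond /=.
  by apply: eq_bigr => y _; rewrite inE -val_eqE; case: ifP.
rewrite !S exchange_big /=; apply: eq_bigr => x _; apply: eq_bigr => y _.
have [i' hi'] := pcc_conv h (c u v).
have -> : c v u = i' by apply/(hi' u v).1.
congr (nat_of_bool _); apply/eqP/eqP => /(hi' y x) //.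
Qed.

Lemma adj_sym (V : finType) (r : nat) (c : V -> V -> 'I_r) :
  is_pcc c -> symmetric (adj c).
Proof.
move=> h u v; rewrite /adj /nondominant (valency_conv u v h) [v == u]eq_sym.
case: eqVneq => //= nuv; congr (_ && _).
have nz (x y : V) : x != y -> c x y != 0%N :> nat.
  by apply: contra_neq => /(pcc_diag h).
by rewrite !nz // eq_sym.
Qed.

Lemma lambdaE (V : finType) (r : nat) (c : V -> V -> 'I_r) (u v : V) :
  is_pcc c ->
  #|sphere c (c u v) u :&: neighborhood c v| = lambda c (c u v).
Proof.
move=> h; set i := c u v.
suff eqs x y : c x y = i ->
    #|sphere c i x :&: neighborhood c y| = #|sphere c i u :&: neighborhood c v|.
  apply/eqP; rewrite eqn_leq; apply/andP; split.
    exact: (@leq_bigmax_cond _ (fun uv : V * V => c uv.1 uv.2 == i :> nat)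
      (fun uv => #|sphere c i uv.1 :&: neighborhood c uv.2|) (u, v)).
  by apply/bigmax_leqP => -[x y] /= /eqP/val_inj/eqs ->.
suff S z w : c z w = i -> #|sphere c i z :&: neighborhood c w| =
   (\sum_(k < r | nondominant c k) #|[set a | (c z a == i) && (c a w == k)]|)%N.
  move=> cxy; rewrite !S //; apply: eq_bigr => k _.
  by have [p hp] := pcc_inter h i i k; rewrite !hp.
move=> czw; rewrite -sum1_card.
rewrite (partition_big (fun a => c a w) (fun k => nondominant c k)) /=.
  apply: eq_bigr => k kP; rewrite -sum1_card; apply: eq_bigl => a.
  rewrite !inE -val_eqE -andbA; congr (_ && _).
  case: eqP => [E|]; last by rewrite andbF.
  rewrite (adj_sym h) /adj E kP !andbT.
  apply/eqP => aw; move: kP.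
  by rewrite -E aw /nondominant /= (pcc_diag h w w).2.
by move=> a; rewrite !inE (adj_sym h) => /andP[_ /andP[]].
Qed.

(* Main.v *)
(* Non-adjacent vertices of G(X) have color 1, so they have at most
   mu = O(rho^2 / n) common neighbors. Hence a vertex outside a maximal clique
   is adjacent to at most mu of its vertices, and two maximal cliques share at
   most mu vertices. The graph induced on X_i(u) is lambda_i-regular, and
   n_i mu <= rho mu = o(n) is o(lambda_i^2); so every v in X_i(u) lies in a
   maximal clique through u that meets X_i(u) in (1 - o(1)) lambda_i vertices.
   Call such cliques i-fat at u. They are disjoint on X_i(u), so there are
   O(rho / n^(1/2)) fat cliques at u, for all i together, and mu times this
   number is o(n^(1/2)).

   The geometry consists of all maximal cliques of order at least s / 2, where
   s = floor(eps n^(1/2)), a condition that does not mention any vertex. Since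
   few fat cliques cover N(u), every line through u is fat at u for some color;
   comparing the degrees from X_i(u) to X_j(u) of the vertices of one i-fat
   clique then shows that a j-fat clique at u that contains v in X_i(u) is the
   i-fat clique containing v. *)

Require Import Defs.
From mathcomp Require Import all_boot all_order all_algebra.
From mathcomp Require Import zify.

Set Implicit Arguments.
Unset Strict Implicit.
Unset Printing Implicit Defensive.

Import Order.TTheory GRing.Theory Num.Theory.

Local Open Scope ring_scope.

(** * Double counting for families of finite sets *)

Section Counting.
Local Open Scope nat_scope.

Variables (I T : finType) (P : pred I) (g : I -> {set T}) (S : {set T}).

Lemma sum_card_exchange :
  \sum_(i | P i) #|g i| = \sum_(x : T) #|[set i | P i && (x \in g i)]|.
Proof.
under eq_bigr do rewrite -sum1_card big_mkcond /=.
rewrite exchange_big /=; apply: eq_bigr => x _.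
rewrite -sum1_card -big_mkcondr /=.
by apply: eq_bigl => i; rewrite inE.
Qed.

Lemma leq_sum_card_disjoint :
  (forall i, P i -> g i \subset S) ->
  (forall i j x, P i -> P j -> x \in g i -> x \in g j -> i = j) ->
  \sum_(i | P i) #|g i| <= #|S|.
Proof.
move=> sub dis; rewrite sum_card_exchange -sum1_card big_mkcond /=.
rewrite [leqRHS]big_mkcond /=; apply: leq_sum => x _.
have [->//|[i]] := set_0Vmem [set i | P i && (x \in g i)].
  by rewrite cards0.
rewrite inE => /andP[Pi xi]; rewrite (subsetP (sub _ Pi) _ xi).
rewrite -(cards1 i); apply/subset_leq_card/subsetP => j.
by rewrite !inE => /andP[Pj xj]; apply/eqP/(dis _ _ x).
Qed.

Lemma leq_card_cover_sum :
  (forall x, x \in S -> exists2 i, P i & x \in g i) ->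
  #|S| <= \sum_(i | P i) #|g i|.
Proof.
move=> cov; rewrite sum_card_exchange -sum1_card big_mkcond /=.
apply: leq_sum => x _; case: ifP => // /cov[i Pi xi].
by apply/card_gt0P; exists i; rewrite inE Pi.
Qed.

End Counting.

(** * Maximal cliques when non-adjacent vertices have few common neighbours *)

Section MaximalCliques.
Local Open Scope nat_scope.

Variables (V : finType) (e : rel V).
Hypotheses (esym : symmetric e) (eirr : irreflexive e).
Let N u : {set V} := [set w | e u w].
Variable mu : nat.
Hypothesis codeg : forall u v, u != v -> ~~ e u v -> #|N u :&: N v| <= mu.

Lemma cliqueP (C : {set V}) :
  reflect {in C &, forall u v, u != v -> e u v} (clique e C).
Proof.
apply: (iffP forall_inP) => [H u v uC vC uv|H u uC].
  by have /forall_inP/(_ v vC)/implyP := H u uC; apply.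
by apply/forall_inP => v vC; apply/implyP => uv; apply: H.
Qed.

(** Maximality gives [y] in [C] not adjacent to [v]; the neighbours of [v] in [C] are then common
    neighbours of [v] and [y]. *)
Lemma leq_card_nbhd_maxclique (C : {set V}) (v : V) :
  maxset (clique e) C -> v \notin C -> #|C :&: N v| <= mu.
Proof.
move=> /maxsetP[/cliqueP cC maxC] vC.
have [y yC nvy] : exists2 y, y \in C & ~~ e v y.
  apply/exists_inP; apply: contraT; rewrite negb_exists_in => /forall_inP H.
  have {}H y : y \in C -> e v y by move/H; rewrite negbK.
  have cvC : clique e (v |: C).
    apply/cliqueP => a b; rewrite !inE.
    move=> /predU1P[->|aC] /predU1P[->|bC] ab.
    - by rewrite eqxx in ab.
    - exact: H.
    - by rewrite esym H.
    - exact: cC.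
  by have := maxC _ cvC (subsetUr _ _) => E; rewrite -E setU11 in vC.
have vy : v != y by apply: contraNneq vC => ->.
apply: leq_trans (codeg vy nvy); apply/subset_leq_card/subsetP => z.
rewrite !inE => /andP[zC vz]; rewrite vz /= cC //.
by apply: contraNneq nvy => ->.
Qed.

Lemma leq_card_setI_maxclique (C D : {set V}) :
  maxset (clique e) C -> maxset (clique e) D -> C != D -> #|C :&: D| <= mu.
Proof.
move=> mC mD CD.
have [x xC xD] : exists2 x, x \in C & x \notin D.
  apply/subsetPn; apply: contra CD => sCD.
  by rewrite (maxsetsup mC (maxsetp mD) sCD).
apply: leq_trans (leq_card_nbhd_maxclique mD xD).
apply/subset_leq_card/subsetP => z.
rewrite !inE => /andP[zC zD]; rewrite zD /=.
apply: (cliqueP _ (maxsetp mC)) => //.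
by apply: contraNneq xD => ->.
Qed.

(* Spielman's argument: the edges leaving the neighbourhood of [v] in [X] are
   counted from outside, where [codeg] applies, so that most vertices of this
   neighbourhood are adjacent to more than two thirds of it; two such vertices
   have more than [mu] common neighbours. *)
Lemma regular_large_clique (X : {set V}) (lam K : nat) (u v : V) :
  (forall x, x \in X -> #|X :&: N x| = lam) ->
  (forall x, x \in X -> e u x) -> v \in X ->
  K <= lam -> 3 * mu <= lam -> K * (#|X| * mu) <= lam * lam ->
  exists C, [/\ maxset (clique e) C, u \in C, v \in C &
                K * lam <= K * #|C :&: X| + 6 * lam].
Proof.
move=> reg uX vX Klam mulam Kmu.
pose Ga := X :&: N v.
have GaX : Ga \subset X by exact: subsetIl.
have cGa : #|Ga| = lam by exact: reg.
pose bad x := #|Ga :\: N x|.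
(* Both [Ga] and the neighbourhood of [x] in [X] have [lam] elements, so their two differences have
   the same size. *)
have bad_out x : x \in Ga -> bad x = #|(X :\: Ga) :&: N x|.
  move=> xGa; have regx := reg x (subsetP GaX _ xGa).
  have := cardsID (N x) Ga; rewrite cGa -regx -(cardsID Ga (X :&: N x)).
  rewrite (setIAC X (N x) Ga) (setIidPr GaX) => /addnI.
  by rewrite setIDAC.
have sum_bad : \sum_(x in Ga) bad x <= lam + #|X| * mu.
  rewrite (eq_bigr _ bad_out) sum_card_exchange.
  have -> : \sum_x #|[set i | (i \in Ga) && (x \in (X :\: Ga) :&: N i)]| =
      \sum_(y in X :\: Ga) #|Ga :&: N y|.
    rewrite [RHS]big_mkcond /=; apply: eq_bigr => y _.
    case: ifP => yX; last first.
      by apply: eq_card0 => x; rewrite in_set in_setI yX andbF.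
    by apply: eq_card => x; rewrite in_set in_setI yX in_setI !in_set [e y x]esym.
  (* The vertex [v] lies outside [Ga] but is adjacent to all of it, which accounts for the term
     [lam]; [codeg] bounds all other terms. *)
  have vXG : v \in X :\: Ga by rewrite !inE vX eirr.
  rewrite (bigD1 v) //= leq_add //.
    by rewrite -cGa; exact/subset_leq_card/subsetIl.
  rewrite -sum_nat_const; apply: leq_trans (_ : \sum_(i in X | i != v) mu <= _).
    rewrite big_mkcond [leqRHS]big_mkcond /=; apply: leq_sum => y _.
    case: ifP => [/andP[yXG yv]|_]; last by case: ifP.
    have yX : y \in X by move: yXG; rewrite inE => /andP[].
    rewrite yX yv /=.
    have nvy : ~~ e v y by move: yXG; rewrite !inE yX andbT.
    rewrite eq_sym in yv; apply: leq_trans (codeg yv nvy).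
    exact/subset_leq_card/setSI/subsetIr.
  rewrite [leqRHS](bigID (fun i => i != v)) /=; exact: leq_addr.
pose Good := [set x in Ga | 3 * bad x <= lam].
have card_Good : #|Ga :\: Good| * lam <= 3 * (lam + #|X| * mu).
  apply: leq_trans (leq_mul (leqnn 3) sum_bad).
  rewrite -sum_nat_const big_distrr /= big_mkcond [leqRHS]big_mkcond /=.
  apply: leq_sum => x _; rewrite !inE; case: ifP => // /andP[].
  rewrite negb_and => /orP[/negbTE -> //|].
  by rewrite -ltnNge => /ltnW h /andP[-> ->].
have cliqueGood : clique e (u |: (v |: Good)).
  have Gv x : x \in Good -> e v x by rewrite !inE => /andP[/andP[]].
  have GX x : x \in Good -> x \in X by rewrite !inE => /andP[/andP[]].
  have uGv x : x \in v |: Good -> e u x.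
    by case/setU1P => [->|/GX]; exact: uX.
  apply/cliqueP => a b /setU1P[->|aG] /setU1P[->|bG] ab.
  - by rewrite eqxx in ab.
  - exact: uGv.
  - by rewrite esym uGv.
  case/setU1P: aG bG ab => [->|aG] /setU1P[->|bG] ab.
  - by rewrite eqxx in ab.
  - exact: Gv.
  - by rewrite esym Gv.
  apply: contraT => nab; have := codeg ab nab; rewrite leqNgt => /negP[].
  (* Two good vertices have at least [lam / 3 >= mu] common neighbours in [Ga]; [v] is one more,
     which exceeds [mu]. *)
  have : #|v |: Ga :&: (N a :&: N b)| <= #|N a :&: N b|.
    apply/subset_leq_card/subsetP => z /setU1P[->|/setIP[]//].
    by rewrite !inE esym (Gv a) // esym (Gv b).
  rewrite cardsU1 !inE eirr andbF /= add1n; apply: leq_trans.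
  have : lam <= #|Ga :&: (N a :&: N b)| + (bad a + bad b).
    rewrite -cGa -(cardsID (N a :&: N b) Ga) leq_add2l setDIr.
    by rewrite (leq_trans (leq_card_setU _ _)).
  have /andP[_ ba] : (a \in Ga) && (3 * bad a <= lam) by rewrite inE in aG.
  have /andP[_ bb] : (b \in Ga) && (3 * bad b <= lam) by rewrite inE in bG.
  lia.
have [C mC sC] := maxset_exists cliqueGood.
exists C; split => //.
- by rewrite (subsetP sC) // !inE eqxx.
- by rewrite (subsetP sC) // !inE eqxx orbT.
have : #|Good| <= #|C :&: X|.
  apply/subset_leq_card/subsetP => x xG; rewrite inE.
  have xGa : x \in Ga by move: xG; rewrite inE => /andP[].
  by rewrite (subsetP GaX) // andbT (subsetP sC) // !in_setU1 xG !orbT.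
have : #|Ga :&: Good| <= #|Good| by exact/subset_leq_card/subsetIr.
have := cardsID Good Ga; rewrite cGa.
case: (posnP lam) => [->|lam0]; first by rewrite muln0.
set g := #|Ga :\: Good| in card_Good *; move: card_Good Kmu => h1 h2 h3 h4 h5.
(* The 6 is 3, from the threshold in [Good], times 2: both [K * lam] and [K * (#|X| * mu)] are at
   most [lam * lam]. *)
suff : K * g <= 6 * lam by nia.
rewrite -(leq_pmul2r lam0); nia.
Qed.

End MaximalCliques.

(** * Counts determined by the colour of a pair *)

Section Coherence.
Local Open Scope nat_scope.

Variables (V : finType) (r : nat) (c : V -> V -> 'I_r).
Hypothesis pccc : is_pcc c.
Local Notation N := (neighborhood c).

Lemma adjE (u v : V) : adj c u v = nondominant c (c u v).
Proof.
rewrite /adj; case: eqVneq => //= ->.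
by rewrite /nondominant (pcc_diag pccc v v).2.
Qed.

Lemma adj_irr : irreflexive (adj c).
Proof. by move=> u; rewrite /adj eqxx. Qed.

(** Classified by the colour [k] of the pair [(a, y)], the vertices [a] are counted by intersection
    numbers, summed over nondominant [k]. *)
Lemma card_sphere_nbhd_eq (j : 'I_r) (x y u v : V) : c x y = c u v ->
  #|sphere c j x :&: N y| = #|sphere c j u :&: N v|.
Proof.
suff S z w : #|sphere c j z :&: N w| =
    \sum_(k < r | nondominant c k) #|[set a | (c z a == j) && (c a w == k)]|.
  move=> E; rewrite !S; apply: eq_bigr => k _.
  by have [p hp] := pcc_inter pccc (c u v) j k; rewrite !hp.
rewrite -sum1_card (partition_big (fun a => c a w) (fun k => nondominant c k)) /=.
  apply: eq_bigr => k kP; rewrite -sum1_card; apply: eq_bigl => a.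
  rewrite !inE (adj_sym pccc) adjE -val_eqE -andbA; congr (_ && _).
  by case: eqP => [->|]; rewrite ?kP // andbF.
by move=> a; rewrite !inE (adj_sym pccc) adjE => /andP[].
Qed.

Lemma card_nbhd_setI_eq (x y u v : V) : c x y = c u v ->
  #|N x :&: N y| = #|N u :&: N v|.
Proof.
suff S z w : #|N z :&: N w| =
    \sum_(k < r | nondominant c k) #|sphere c k z :&: N w|.
  by move=> E; rewrite !S; apply: eq_bigr => k _; exact: card_sphere_nbhd_eq.
rewrite -sum1_card (partition_big (fun a => c z a) (fun k => nondominant c k)) /=.
  apply: eq_bigr => k kP; rewrite -sum1_card; apply: eq_bigl => a.
  rewrite !inE (adjE z) -val_eqE andbC.
  by case: eqP => //= ->; rewrite kP.
by move=> a; rewrite !inE adjE => /andP[].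
Qed.

End Coherence.

(** * Fat cliques and the clique geometry of a single configuration *)

Section Lines.
Local Open Scope nat_scope.

Variables (V : finType) (r : nat) (c : V -> V -> 'I_r).
Local Notation N := (neighborhood c).

Definition maximal_clique (C : {set V}) : bool := maxset (clique (adj c)) C.

Definition lines (s : nat) : {set {set V}} :=
  [set C | maximal_clique C & s <= 2 * #|C|].

(** The ratio 3/4 exceeds 1/2, whence [fat_uniq], and lies below [1 - 6 / K], which [fat_exists]
    attains. *)
Definition fat (u : V) (i : 'I_r) (C : {set V}) : bool :=
  [&& maximal_clique C, u \in C & 3 * lambda c i <= 4 * #|C :&: sphere c i u|].

(** These stand for the floor of [eps * n^(1/2)], for [rho], for [2 * rho^2 / n], and for a
    precision: the relative errors are at most [6 / K]. *)
Variables (s d mu K : nat).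
Hypothesis pccc : is_pcc c.
Hypothesis degN : forall u, #|N u| <= d.
Hypothesis codeg : forall u v, u != v -> ~~ adj c u v -> #|N u :&: N v| <= mu.
Hypothesis lamb : forall i : 'I_r, nondominant c i -> s <= lambda c i.
Hypotheses (K100 : 100 <= K) (Ks : K <= s) (Kdmu : K * (d * mu) <= s * s).

Lemma sphere_sub_nbhd (i : 'I_r) (u : V) :
  nondominant c i -> sphere c i u \subset N u.
Proof.
by move=> ndi; apply/subsetP => v; rewrite !inE adjE // => /eqP ->.
Qed.

(** A pair of colour [i] shows that [s <= lambda c i <= d]; then one factor [s] cancels in
    [Kdmu]. *)
Lemma leq_mu_s (i : 'I_r) (u v : V) : nondominant c i -> c u v = i ->
  K * mu <= s.
Proof.
move=> ndi cuv; have sd : s <= d.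
  apply: leq_trans (lamb ndi) (leq_trans _ (degN u)).
  rewrite -cuv -(lambdaE u v pccc) cuv.
  exact: leq_trans (subset_leq_card (subsetIl _ _))
                   (subset_leq_card (sphere_sub_nbhd _ ndi)).
have s0 : 0 < s by lia.
rewrite -(leq_pmul2r s0); nia.
Qed.

Lemma leq_card_clique_sphere (C : {set V}) (i : 'I_r) (u v : V) :
  maximal_clique C -> v \in C -> c u v = i ->
  #|C :&: sphere c i u| <= (lambda c i).+1.
Proof.
move=> mC vC cuv; rewrite (cardsD1 v) -add1n leq_add ?leq_b1 //.
rewrite -cuv -(lambdaE u v pccc); apply/subset_leq_card/subsetP => w.
rewrite !inE cuv => /andP[wv /andP[wC ->]] /=.
by apply: (cliqueP _ _ (maxsetp mC)) => //; rewrite eq_sym.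
Qed.

Lemma fat_exists (i : 'I_r) (u v : V) : nondominant c i -> c u v = i ->
  exists C, [/\ fat u i C, v \in C &
                K * lambda c i <= K * #|C :&: sphere c i u| + 6 * lambda c i].
Proof.
move=> ndi cuv; have mus := leq_mu_s ndi cuv; have ls := lamb ndi.
have vX : v \in sphere c i u by rewrite inE cuv.
have [||||||C [mC uC vC cC]] := @regular_large_clique V (adj c) (adj_sym pccc)
    (adj_irr c) mu codeg (sphere c i u) (lambda c i) K u v => //.
- by move=> x; rewrite inE => /eqP/val_inj cux; rewrite -cux lambdaE.
- by move=> x /(subsetP (sphere_sub_nbhd _ ndi)); rewrite inE.
- lia.
- nia.
- have := leq_trans (subset_leq_card (sphere_sub_nbhd u ndi)) (degN u).
  by move=> h; apply: leq_trans (leq_mul ls ls); apply: leq_trans Kdmu;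
     rewrite leq_mul2l leq_mul2r h !orbT.
exists C; split => //; rewrite /fat /maximal_clique mC uC /=; nia.
Qed.

(** Distinct [C] and [D] share at most [mu] vertices, so their traces on [X_i(u)] would cover almost
    [3/2 * lambda c i] vertices, all equal or adjacent to [v]. *)
Lemma fat_uniq (i : 'I_r) (u v : V) (C D : {set V}) :
  nondominant c i -> c u v = i -> fat u i C -> fat u i D ->
  v \in C -> v \in D -> C = D.
Proof.
move=> ndi cuv /and3P[mC uC fC] /and3P[mD uD fD] vC vD.
apply/eqP/contraT => CD.
have CDmu := leq_card_setI_maxclique (adj_sym pccc) codeg mC mD CD.
have mus := leq_mu_s ndi cuv; have ls := lamb ndi.
pose X := sphere c i u.
have cap : #|(C :&: X) :&: (D :&: X)| <= mu.
  by apply: leq_trans CDmu; apply/subset_leq_card/setISS; exact: subsetIl.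
have cup : #|(C :&: X) :|: (D :&: X)| <= (lambda c i).+1.
  rewrite (cardsD1 v) -add1n leq_add ?leq_b1 //.
  rewrite -cuv -(lambdaE u v pccc); apply/subset_leq_card/subsetP => w.
  rewrite !inE cuv -andb_orl => /andP[wv /andP[wCD ->]] /=.
  case/orP: wCD => wE.
    by apply: (cliqueP _ _ (maxsetp mC)) => //; rewrite eq_sym.
  by apply: (cliqueP _ _ (maxsetp mD)) => //; rewrite eq_sym.
have := cardsUI (C :&: X) (D :&: X); rewrite -/X in fC fD; nia.
Qed.

Definition fat_pairs (u : V) : {set 'I_r * {set V}} :=
  [set p : 'I_r * {set V} | nondominant c p.1 && fat u p.1 p.2].

(** By [fat_uniq] the traces are disjoint in [N u], and each has at least [3/4 * s] vertices. So
    there are at most [4 * d / (3 * s)] pairs, and [Kdmu] with [K >= 100] gives the constant 75. *)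
Lemma card_fat_pairs (u : V) : 75 * (#|fat_pairs u| * mu) <= s.
Proof.
have [->|[[i C] iC]] := set_0Vmem (fat_pairs u); first by rewrite cards0.
have sF : \sum_(p in fat_pairs u) #|p.2 :&: sphere c p.1 u| <= #|N u|.
  apply: leq_sum_card_disjoint.
    move=> p; rewrite inE => /andP[ndp _].
    exact: subset_trans (subsetIr _ _) (sphere_sub_nbhd _ ndp).
  move=> [j D] [k E] x; rewrite !inE /=.
  move=> /andP[ndj fD] /andP[ndk fE] /andP[xD /eqP/val_inj cj].
  move=> /andP[xE /eqP/val_inj ck]; move: ndk fE; rewrite -ck cj => _ fE.
  by rewrite (fat_uniq ndj cj fD fE xD xE).
have : 3 * s * #|fat_pairs u| <= 4 * d.
  apply: leq_trans (leq_mul (leqnn 4) (leq_trans sF (degN u))).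
  rewrite mulnC -sum_nat_const big_distrr /=; apply: leq_sum => p.
  rewrite inE => /andP[ndp /and3P[_ _]]; apply: leq_trans.
  by rewrite leq_mul2l lamb.
have s0 : 0 < s by lia.
move=> h; rewrite -(leq_pmul2r s0).
set f := #|fat_pairs u| in h *.
have h1 : 3 * s * f * mu <= 4 * d * mu by rewrite leq_mul2r h orbT.
have h2 : K * (3 * s * f * mu) <= 4 * (s * s) by nia.
have h3 : 100 * (3 * s * f * mu) <= 4 * (s * s).
  by apply: leq_trans h2; rewrite leq_mul2r K100 orbT.
nia.
Qed.

(** The fat cliques at [u] cover [N u]. If [C] were none of them, each would meet it in at most [mu]
    vertices, so [C] would have at most [1 + s / 75] vertices. *)
Lemma line_fat (C : {set V}) (u : V) : C \in lines s -> u \in C ->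
  exists2 i : 'I_r, nondominant c i & fat u i C.
Proof.
rewrite inE => /andP[mC sC] uC.
have cF := card_fat_pairs u.
have [[i D] /=|nF] := pickP [pred p in fat_pairs u | p.2 == C].
  by case/andP; rewrite inE => /andP[ndi fD] /eqP <-; exists i.
have : #|C :\ u| <= \sum_(p in fat_pairs u) #|C :&: p.2|.
  apply: leq_card_cover_sum => v /setD1P[vu vC].
  have : adj c u v.
    by apply: (cliqueP _ _ (maxsetp mC)) => //; rewrite eq_sym.
  rewrite adjE // => nd; have [D [fD vD _]] := fat_exists nd (erefl (c u v)).
  by exists (c u v, D); rewrite inE /= ?nd ?vC.
have : \sum_(p in fat_pairs u) #|C :&: p.2| <= #|fat_pairs u| * mu.
  rewrite -sum_nat_const; apply: leq_sum => p pF.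
  have := nF p; rewrite /= pF /= => /negbT; rewrite eq_sym => Cp.
  apply: (leq_card_setI_maxclique (adj_sym pccc) codeg mC _ Cp).
  by move: pF; rewrite inE => /andP[_ /and3P[]].
move: cF; have := cardsD1 u C; rewrite uC; lia.
Qed.

(* Coherence makes [#|sphere c j u :&: N v|] the same for all [v] with
   [c u v = i]; up to an error below [s], it is the sum of [#|C :&: sphere c j u|]
   over the [j]-fat cliques [C] through [u] and [v]. *)
Lemma line_uniq (C : {set V}) (u v : V) (i : 'I_r) (L : {set V}) :
  C \in lines s -> u \in C -> v \in C -> nondominant c i -> c u v = i ->
  fat u i L -> v \in L -> C = L.
Proof.
move=> lC uC vC ndi cuv fL vL.
have [j ndj fC] := line_fat lC uC.
have [E|ij] := eqVneq j i; first by subst j; exact: fat_uniq fC fL vC vL.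
apply/eqP/contraT => CL.
pose Fj := [set D | fat u j D].
have cF : 75 * (#|Fj| * mu) <= s.
  apply: leq_trans (card_fat_pairs u).
  rewrite leq_mul2l leq_mul2r; apply/orP; right; apply/orP; right.
  rewrite -(card_imset (mem Fj) (f := fun D => (j, D))); last by move=> ? ? [].
  apply/subset_leq_card/subsetP => p /imsetP[D].
  by rewrite !inE => fD ->; rewrite /= ndj.
have [mL uL cL] := and3P fL.
have Xmax D : fat u j D -> maximal_clique D by case/and3P.
(* The other [j]-fat cliques cover at most [s / 75] vertices of [L], fewer than its trace on
   [X_i(u)], so some [v0] in this trace avoids them. *)
have [v0 v0A v0P] : exists2 v0, v0 \in L :&: sphere c i u &
    forall D, fat u j D -> v0 \in D -> D = L.
  suff : [exists w in L :&: sphere c i u,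
           [forall D, fat u j D && (w \in D) ==> (D == L)]].
    case/exists_inP => w wA /forallP wP; exists w => // D fD wD.
    by apply/eqP; have := wP D; rewrite fD wD.
  apply: contraT; rewrite negb_exists_in => /forall_inP H.
  have : #|L :&: sphere c i u| <= \sum_(D in Fj | D != L) #|L :&: D|.
    apply: leq_card_cover_sum => w wA.
    have := H w wA; rewrite negb_forall => /existsP[D].
    rewrite negb_imply => /andP[/andP[fD wD] DL]; exists D; first by rewrite inE fD.
    by move: wA; rewrite !inE wD andbT => /andP[].
  have : \sum_(D in Fj | D != L) #|L :&: D| <= #|Fj| * mu.
    rewrite -sum_nat_const big_mkcondr; apply: leq_sum => D.
    rewrite inE => /Xmax mD; case: ifP => // DL.
    apply: (leq_card_setI_maxclique (adj_sym pccc) codeg mL mD).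
    by rewrite eq_sym.
  have := lamb ndi; lia.
have cv0 : c u v0 = i by move: v0A; rewrite !inE => /andP[_ /eqP/val_inj].
have v0L : v0 \in L by move: v0A; rewrite inE => /andP[].
have codv : #|sphere c j u :&: N v| = #|sphere c j u :&: N v0|.
  by apply: card_sphere_nbhd_eq => //; rewrite cuv.
(* The error term at [v0]: none of these cliques contains [v0], so each holds at most [mu] of its
   neighbours. *)
pose far := \sum_(D in Fj | D != L) #|D :&: N v0|.
have far_mu : far <= #|Fj| * mu.
  rewrite -sum_nat_const /far big_mkcondr; apply: leq_sum => D.
  rewrite inE => fD; case: ifP => // DL.
  apply: (leq_card_nbhd_maxclique (adj_sym pccc) codeg (Xmax _ fD)).
  by apply: contraNN DL => v0D; rewrite (v0P D).
have sub_v D : fat u j D -> v \in D -> D :&: sphere c j u \subset sphere c j u :&: N v.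
  move=> /Xmax mD vD; apply/subsetP => w; rewrite !inE => /andP[wD cw].
  rewrite cw /=; apply: (cliqueP _ _ (maxsetp mD)) => //.
  by apply: contraNneq ij => vw; move: cw; rewrite -vw cuv eq_sym val_eqE.
have cover w : w \in sphere c j u :&: N v0 -> exists2 D, D \in Fj & w \in D.
  rewrite !inE => /andP[/eqP/val_inj cw _].
  have [D [fD wD _]] := fat_exists ndj cw.
  by exists D => //; rewrite inE.
have fC4 : 3 * lambda c j <= 4 * #|C :&: sphere c j u| by case/and3P: fC.
have ls := lamb ndj.
have cvC := subset_leq_card (sub_v C fC vC).
(* If [L] is not [j]-fat, the count at [v0] is at most [far], while at [v] it includes the trace of
   [C]. Otherwise the trace of [L] appears on both sides and cancels; that of [C], disjoint from it,
   still exceeds [far]. *)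
have [fjL|nfjL] := boolP (fat u j L); last first.
  have : #|sphere c j u :&: N v0| <= far.
    rewrite /far.
    apply: leq_card_cover_sum => w wX; have [D DF wD] := cover w wX.
    exists D; last by move: wX; rewrite !inE wD => /andP[].
    by rewrite DF; apply: contraNneq nfjL => <-; rewrite inE in DF.
  move: far_mu cF ls fC4 cvC; rewrite codv.
  move: (#|Fj| * mu) far #|C :&: _| #|_ :&: N v0| (lambda c j) => f g a x l.
  by move: K100 Ks; clear; lia.
have fL4 : 3 * lambda c j <= 4 * #|L :&: sphere c j u| by case/and3P: fjL.
have [w0 /setIP[w0L w0X]] : exists w, w \in L :&: sphere c j u.
  apply/card_gt0P; move: fL4 ls K100 Ks.
  by move: #|L :&: _| (lambda c j) => a l; clear; lia.
have cw0 : c u w0 = j by move: w0X; rewrite inE => /eqP/val_inj.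
have cLj := leq_card_clique_sphere mL w0L cw0.
have cCL : #|C :&: sphere c j u| + #|L :&: sphere c j u| <= #|sphere c j u :&: N v|.
  rewrite -cardsUI (_ : (C :&: _) :&: (L :&: _) = set0) ?cards0 ?addn0.
    by apply: subset_leq_card; rewrite subUset !sub_v.
  apply/setP => w; rewrite !inE; apply: contraNF CL.
  move=> /andP[/andP[wC /eqP/val_inj cw] /andP[wL _]].
  by rewrite (fat_uniq ndj cw fC fjL wC wL).
have : #|sphere c j u :&: N v0| <= #|L :&: sphere c j u| + far.
  rewrite -(cardsID L) leq_add //; first by apply/subset_leq_card/subsetP => w;
    rewrite !inE => /andP[/andP[-> _] ->].
  apply: leq_card_cover_sum => w; rewrite inE => /andP[wL wX].
  have [D DF wD] := cover w wX.
  exists D; last by move: wX; rewrite !inE wD => /andP[].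
  by rewrite DF; apply: contraNneq wL => <-.
move: far_mu cF ls fC4 fL4 cLj cCL; rewrite codv.
move: (#|Fj| * mu) far #|C :&: _| #|L :&: _| #|_ :&: N v0| (lambda c j).
by move: K100 Ks; clear; lia.
Qed.

Lemma lines_clique_geometry : clique_geometry c (lines s).
Proof.
split=> [C|u v]; first by rewrite inE => /andP[].
rewrite adjE // => nd; have [C [fC vC _]] := fat_exists nd (erefl (c u v)).
have [mC uC cC] := and3P fC; have ls := lamb nd.
exists C; split.
  split => //; rewrite inE mC /=.
  have := subset_leq_card (subsetIl C (sphere c (c u v) u)); lia.
by move=> D [lD uD vD]; rewrite (line_uniq lD uD vD nd (erefl _) fC vC).
Qed.

(** By [line_uniq], [C] is the clique built by [fat_exists], whose trace is much larger than fatness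
    alone requires. *)
Lemma lines_uniform (C : {set V}) (u : V) (i : 'I_r) :
  C \in lines s -> u \in C -> nondominant c i -> C :&: sphere c i u != set0 ->
  K * lambda c i <= K * #|C :&: sphere c i u| + 6 * lambda c i /\
  #|C :&: sphere c i u| <= (lambda c i).+1.
Proof.
move=> lC uC ndi /set0Pn[v /setIP[vC]]; rewrite inE => /eqP/val_inj cv.
have [L [fL vL cL]] := fat_exists ndi cv.
have E := line_uniq lC uC vC ndi cv fL vL; subst L.
by split=> //; apply: leq_card_clique_sphere vC cv; case/and3P: fL.
Qed.

End Lines.

(** * Degrees and codegrees of [G(X)] when colour 1 is dominant *)

Section Dominant.
Local Open Scope nat_scope.

Variables (V : finType) (r : nat) (c : V -> V -> 'I_r).
Hypothesis pccc : is_pcc c.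
Hypothesis dom1 : #|V| < 2 * valency c 1.
Local Notation N := (neighborhood c).

(** Here 1 is a natural number, whereas [valencyE] takes a colour in ['I_r]; [dom1] ensures that
    colour 1 occurs. *)
Lemma card_sphere1 (u : V) : #|sphere c 1 u| = valency c 1.
Proof.
have [/existsP[x /existsP[y /eqP cxy]]|no1] :=
    boolP [exists x, exists y, c x y == 1 :> nat].
  by have := valencyE (c x y) u pccc; rewrite cxy.
have v1 : valency c 1 = 0.
  apply/eqP; rewrite -leqn0; apply/bigmax_leqP => x _.
  rewrite leqn0 cards_eq0; apply/eqP/setP => y; rewrite !inE.
  apply: contraNF no1 => cxy.
  by apply/existsP; exists x; apply/existsP; exists y.
by move: dom1; rewrite v1.
Qed.

Lemma sphere1_notin (u : V) : u \notin sphere c 1 u.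
Proof. by rewrite inE (pcc_diag pccc u u).2. Qed.

Lemma card_nbhd_le_rho (u : V) : #|N u| <= rho c.
Proof.
have : N u \subset ~: (u |: sphere c 1 u).
  apply/subsetP => v; rewrite !inE adjE // negb_or eq_sym => nd.
  apply/andP; split.
    by apply: contraL nd => /eqP <-; rewrite -adjE // adj_irr.
  by apply: contraL nd => /eqP ->; rewrite /nondominant; move: dom1; lia.
move/subset_leq_card; have := cardsC (u |: sphere c 1 u).
by rewrite cardsU1 sphere1_notin card_sphere1 /rho; lia.
Qed.

(** Another colour of valency at least [n / 2] would give a sphere disjoint from [X_1(u)], which has
    more than [n / 2] vertices. *)
Lemma nonadj_color1 (u v : V) : u != v -> ~~ adj c u v -> c u v = 1 :> nat.
Proof.
move=> uv; rewrite adjE // /nondominant negb_and negbK -leqNgt.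
case/orP => [/eqP/(pcc_diag pccc) E|]; first by rewrite E eqxx in uv.
rewrite -(valencyE _ u pccc) => h; apply/eqP; apply: contraT => c1.
have : #|sphere c (c u v) u :|: sphere c 1 u| <= #|V| by exact: max_card.
have -> : #|sphere c (c u v) u :|: sphere c 1 u| =
          #|sphere c (c u v) u| + #|sphere c 1 u|.
  rewrite -cardsUI (_ : _ :&: _ = set0) ?cards0 ?addn0 //.
  by apply/setP => w; rewrite !inE; apply: contraNF c1 => /andP[/eqP <-].
rewrite card_sphere1; move: dom1; lia.
Qed.

(** The number [m] is the same for every [x] in [X_1(u)]. Counting paths from [u] through a
    neighbour to such an [x] gives [n_1 * m <= rho^2], and [n < 2 * n_1]. *)
Lemma nonadj_codeg (u v : V) : u != v -> ~~ adj c u v ->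
  #|V| * #|N u :&: N v| <= 2 * rho c ^ 2.
Proof.
move=> uv nuv; set m := #|N u :&: N v|.
suff : valency c 1 * m <= rho c ^ 2 by move: dom1; nia.
rewrite -(card_sphere1 u) -sum_nat_const.
apply: leq_trans (_ : \sum_(x in sphere c 1 u) #|N u :&: N x| <= _).
  apply: leq_sum => x; rewrite inE => /eqP cx.
  have -> // : m = #|N u :&: N x|.
  by apply: card_nbhd_setI_eq => //; apply: val_inj; rewrite /= cx nonadj_color1.
rewrite sum_card_exchange (bigID (mem (N u))) /= [X in _ + X]big1 ?addn0.
  rewrite -mulnn; apply: leq_trans (leq_mul (card_nbhd_le_rho u) (leqnn _)).
  rewrite -sum_nat_const; apply: leq_sum => w wN.
  apply: leq_trans (card_nbhd_le_rho w); apply/subset_leq_card/subsetP => x.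
  by rewrite !inE (adj_sym pccc x) => /and3P[].
move=> w; rewrite inE => wN; apply: eq_card0 => x.
by rewrite !inE (negbTE wN) andbF.
Qed.

End Dominant.

From mathcomp Require Import all_classical all_reals all_analysis.
From mathcomp Require Import ring lra.
Import numFieldNormedType.Exports.
Local Open Scope classical_set_scope.

(** * Real estimates for the deviation and for the parameters *)

Section Estimates.
Variable R : realType.

Lemma deviation_le (V : finType) (r : nat) (c : V -> V -> 'I_r)
    (G : {set {set V}}) (K : nat) :
  (100 <= K)%N ->
  (forall C u (i : 'I_r), C \in G -> u \in C -> nondominant c i ->
     C :&: sphere c i u != finset.set0 ->
     [/\ (K <= lambda c i)%N,
       (K * lambda c i <= K * #|C :&: sphere c i u| + 6 * lambda c i)%N &
       (#|C :&: sphere c i u| <= (lambda c i).+1)%N]) ->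
  `|deviation R c G| <= 6 / K%:R.
Proof.
move=> K100 H.
have K0 : 0 < K%:R :> R by rewrite ltr0n; lia.
have b0 : 0 <= 6 / K%:R :> R by rewrite divr_ge0 // ltW.
rewrite ger0_norm; last exact: bigmax_ge_id.
apply: bigmax_le => // C CG; apply: bigmax_le => // u uC.
apply: bigmax_le => // i /andP[ndi C0].
have [Kl lo up] := H C u i CG uC ndi C0.
move: lo up Kl; move: #|C :&: _| (lambda c i) => a l.
rewrite -(ler_nat R) natrD !natrM => lo.
rewrite -(ler_nat R) -natr1 => up; rewrite -(ler_nat R) => Kl.
have l0 : 0 < l%:R :> R by exact: lt_le_trans Kl.
rewrite ler_norml; apply/andP; split.
  rewrite lerBrDr ler_pdivlMr // -(ler_pM2l K0).
  have -> : K%:R * ((- (6 / K%:R) + 1) * l%:R) = (- 6 + K%:R) * l%:R :> R.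
    by field; exact: lt0r_neq0.
  by nra.
rewrite lerBlDr ler_pdivrMr // -(ler_pM2l K0).
have -> : K%:R * ((6 / K%:R + 1) * l%:R) = (6 + K%:R) * l%:R :> R.
  by field; exact: lt0r_neq0.
by nra.
Qed.

Definition scale (eps : R) (n : nat) : nat := Num.truncn (eps * (n%:R `^ (1 / 2))).

Lemma sqrt_powR (n : nat) : (n%:R `^ (1 / 2) : R) ^+ 2 = n%:R.
Proof.
rewrite -powR_mulrn ?powR_ge0 // -powRrM (_ : 1 / 2 * 2 = 1); last by field.
by rewrite powRr1.
Qed.

Lemma cube_powR (n : nat) : (n%:R `^ (2 / 3) : R) ^+ 3 = n%:R ^+ 2.
Proof.
rewrite -powR_mulrn ?powR_ge0 // -powRrM (_ : 2 / 3 * 3 = 2); last by field.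
by rewrite powR_mulrn.
Qed.

(** Truncation loses less than 1, at most half of a number that is at least [K >= 2]; squaring gives
    the factor 4. *)
Lemma scale_ge (eps : R) (K n : nat) : 0 < eps -> (2 <= K)%N ->
  K%:R ^+ 2 <= eps ^+ 2 * n%:R ->
  (K <= scale eps n)%N /\ eps ^+ 2 * n%:R <= 4 * (scale eps n)%:R ^+ 2.
Proof.
move=> e0 K2 h; rewrite -sqrt_powR in h *; set y := _ `^ _ in h *.
have y0 : 0 <= y by exact: powR_ge0.
have K2R : 2 <= K%:R :> R by rewrite ler_nat.
have ey0 : 0 <= eps * y by rewrite mulr_ge0 // ltW.
have Ky : K%:R <= eps * y by rewrite -ler_sqr ?nnegrE // exprMn.
have /andP[_ tr] := truncn_itv ey0.
rewrite /scale -/y; split.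
  by rewrite -ltnS -(ltr_nat R); exact: le_lt_trans tr.
rewrite -natr1 in tr; move: (_%:R) tr => z tr.
rewrite -exprMn; nra.
Qed.

(* With [mu := 2 rho^2 / n] the hypothesis [K rho mu <= s^2] of the finite
   statement reads [rho^3 <= const n^2]. *)
Lemma scale_bound (eps dlt : R) (K n rh : nat) : (0 < n)%N ->
  0 < dlt -> dlt <= 1 -> 8 * K%:R * dlt <= eps ^+ 2 ->
  eps ^+ 2 * n%:R <= 4 * (scale eps n)%:R ^+ 2 ->
  rh%:R <= dlt * (n%:R `^ (2 / 3)) ->
  (K * (rh * (2 * rh ^ 2 %/ n)) <= scale eps n * scale eps n)%N.
Proof.
move=> n0 d0 d1 Kd sc rhd.
have rh3 : rh%:R ^+ 3 <= dlt * n%:R ^+ 2 :> R.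
  apply: le_trans (_ : dlt ^+ 3 * n%:R ^+ 2 <= _).
    by rewrite -cube_powR -exprMn lerXn2r ?nnegrE ?mulr_ge0 ?powR_ge0 // ltW.
  rewrite ler_wpM2r ?sqr_ge0 // -[leRHS]expr1.
  by apply: ler_wiXn2l => //; exact: ltW.
have : (n * (2 * rh ^ 2 %/ n) <= 2 * rh ^ 2)%N by rewrite mulnC leq_trunc_div.
move: (_ %/ _)%N => mu hmu.
rewrite -(leq_pmul2l n0) -(ler_nat R) !natrM.
move: hmu; rewrite -(ler_nat R) !natrM -expr2 => hmu.
have nR : 0 < n%:R :> R by rewrite ltr0n.
have h1 : n%:R * (K%:R * (rh%:R * mu%:R)) <= 2 * K%:R * rh%:R ^+ 3 :> R.
  have -> : n%:R * (K%:R * (rh%:R * mu%:R)) = K%:R * rh%:R * (n%:R * mu%:R) :> R by ring.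
  have -> : 2 * K%:R * rh%:R ^+ 3 = K%:R * rh%:R * (2 * rh%:R ^+ 2) :> R by ring.
  by rewrite ler_wpM2l // mulr_ge0.
have h2 : 2 * K%:R * rh%:R ^+ 3 <= 2 * K%:R * (dlt * n%:R ^+ 2) :> R.
  by rewrite ler_wpM2l // mulr_ge0.
apply: le_trans h1 (le_trans h2 _); rewrite -expr2.
rewrite -(ler_pM2l (ltr0n R 4)).
have h3 : 8 * K%:R * dlt * n%:R ^+ 2 <= eps ^+ 2 * n%:R ^+ 2 by rewrite ler_wpM2r ?sqr_ge0.
have h4 : n%:R * (eps ^+ 2 * n%:R) <= n%:R * (4 * (scale eps n)%:R ^+ 2) :> R by rewrite ler_wpM2l.
nra.
Qed.

End Estimates.

(** * From single configurations to the sequence *)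

Theorem theorem2p4 (R : realType) (eps : R) (V : nat -> finType)
    (r : nat -> nat) (c : forall t : nat, V t -> V t -> 'I_(r t)) :
  0 < eps ->
  (forall t : nat, is_pcc (c t)) ->
  #|V t| @[t --> \oo] --> \oo ->
  (rho (c t))%:R / (#|V t|%:R `^ (2 / 3)) @[t --> \oo] --> (0 : R) ->
  (forall (t : nat) (i : 'I_(r t)), nondominant (c t) i ->
     eps * (#|V t|%:R `^ (1 / 2)) <= (lambda (c t) i)%:R) ->
  exists G : forall t : nat, {set {set V t}},
    (exists T : nat, forall t : nat, (T <= t)%N -> clique_geometry (c t) (G t))
    /\ asymptotically_uniform R c G.
Proof.
move=> e0 pccc Vy rho0 lam.
pose G t := lines (c t) (scale eps #|V t|); exists G.
(* The family [G] does not depend on [K]: the value 100 already yields geometries, and larger values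
   make the deviation tend to 0. *)
suff key (K : nat) : (100 <= K)%N -> exists T : nat, forall t, (T <= t)%N ->
    clique_geometry (c t) (G t) /\ `|deviation R (c t) (G t)| <= 6 / K%:R.
  split; first by have [T HT] := key 100%N isT; exists T => t /HT[].
  apply/cvgr0Pnorm_le => e epos.
  have [T HT] := key (100 + Num.bound (6 / e))%N (leq_addr _ _).
  exists T => // t /= /HT[_ /le_trans]; apply.
  rewrite ler_pdivrMr ?ltr0n // mulrC -ler_pdivrMr //.
  apply: le_trans (_ : (Num.bound (6 / e))%:R <= _); last first.
    by rewrite ler_nat leq_addl.
  by apply/ltW; apply: le_lt_trans (archi_boundP _); rewrite ?divr_ge0 // ltW.
move=> K100.
have K0 : 0 < K%:R :> R by rewrite ltr0n; lia.
(* The bound [1 / 8] gives [8 * rho <= n], hence a dominant colour 1; the other bound is what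
   [scale_bound] requires. *)
pose dlt : R := Num.min (1 / 8) (eps ^+ 2 / (8 * K%:R)).
have d0 : 0 < dlt by rewrite lt_min !divr_gt0 ?mulr_gt0 ?exprn_gt0.
have d8 : dlt <= 1 / 8 by rewrite ge_min lexx.
have dK : 8 * K%:R * dlt <= eps ^+ 2.
  by rewrite mulrC -ler_pdivlMr ?mulr_gt0 // ge_min lexx orbT.
(* The second summand ensures [K^2 <= eps^2 * n], that is, [K <= eps * n^(1/2)]. *)
pose n0 := (8 + Num.bound (K%:R ^+ 2 / eps ^+ 2))%N.
have [T1 _ HT1] : \forall t \near \oo, (n0 <= #|V t|)%N by move/cvgnyPge : Vy; exact.
have [T2 _ HT2] : \forall t \near \oo,
    `|(rho (c t))%:R / (#|V t|%:R `^ (2 / 3))| <= dlt by move/cvgr0Pnorm_le : rho0; exact.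
exists (maxn T1 T2) => t; rewrite geq_max => /andP[tT1 tT2].
have {tT1} := HT1 _ tT1; have {tT2} := HT2 _ tT2; rewrite /= => rhon nn0.
set n := #|V t| in nn0 rhon *.
have n8 : (8 <= n)%N by exact: leq_trans (leq_addr _ _) nn0.
have n_gt0 : (0 < n)%N by exact: leq_trans n8.
have n1 : 1 <= n%:R :> R by rewrite ler1n.
have npow : 0 < n%:R `^ (2 / 3) :> R by rewrite powR_gt0; lra.
have {}rhon : (rho (c t))%:R <= dlt * (n%:R `^ (2 / 3)).
  by rewrite -ler_pdivrMr //; apply: le_trans rhon; exact: ler_norm.
have dom1 : (#|V t| < 2 * valency (c t) 1)%N.
  have : (8 * rho (c t) <= n)%N.
    rewrite -(ler_nat R) natrM.
    have : n%:R `^ (2 / 3) <= n%:R :> R.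
      by rewrite -[leRHS]powRr1 // ler_powR //; lra.
    nra.
  rewrite /rho -/n; lia.
have Kn : K%:R ^+ 2 <= eps ^+ 2 * n%:R.
  rewrite mulrC -ler_pdivrMr ?exprn_gt0 //.
  apply: le_trans (_ : (Num.bound (K%:R ^+ 2 / eps ^+ 2))%:R <= _).
    by apply/ltW/archi_boundP; rewrite divr_ge0 ?exprn_ge0 // ltW.
  by rewrite ler_nat; apply: leq_trans nn0; exact: leq_addl.
have [Ks sn] := scale_ge e0 (leq_trans (isT : (2 <= 100)%N) K100) Kn.
have lams (i : 'I_(r t)) : nondominant (c t) i -> (scale eps n <= lambda (c t) i)%N.
  move=> /lam; rewrite -(ler_nat R); apply: le_trans.
  by rewrite truncn_le // mulr_ge0 ?powR_ge0 // ltW.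
have codeg (u v : V t) : u != v -> ~~ adj (c t) u v ->
    (#|neighborhood (c t) u :&: neighborhood (c t) v| <= 2 * rho (c t) ^ 2 %/ n)%N.
  move=> uv nuv; rewrite leq_divRL // mulnC.
  exact: nonadj_codeg.
have bnd : (K * (rho (c t) * (2 * rho (c t) ^ 2 %/ n)) <= scale eps n * scale eps n)%N.
  by apply: scale_bound d0 _ dK sn rhon; [|lra].
split.
  exact: lines_clique_geometry (pccc t) (card_nbhd_le_rho (pccc t) dom1) codeg lams K100 Ks bnd.
apply: deviation_le => // C u i CG uC ndi CX.
have [lo up] := lines_uniform (pccc t) (card_nbhd_le_rho (pccc t) dom1)
  codeg lams K100 Ks bnd CG uC ndi CX.
by split => //; exact: leq_trans Ks (lams _ ndi).
Qed.
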